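(* Let $d$ be a nonnegative integer and let $\Gamma$ be a connected regular graph whose adjacency matrix has exactly $d+1$ distinct eigenvalues and whose odd-girth is finite and at least $2d+1$. Then $\Gamma$ is a distance-regular generalized odd graph; that is, $\Gamma$ is distance-regular and, with $D$ denoting its diameter, its odd-girth equals $2D+1$.
   Context: Graphs are finite, simple and undirected. The odd-girth of a graph is the length of its shortest odd cycle (it is finite if and only if the graph is not bipartite). A connected graph of diameter $D$ is distance-regular if for all $0\le h,i,j\le D$ and all vertices $u,v$ at distance $h$, the number of vertices at distance $i$ from $u$ and at distance $j$ from $v$ depends only on $h,i,j$. A generalized odd graph is a distance-regular graph of diameter $D$ and odd-girth $2D+1$. *)

(* Defs.v *)
From mathcomp Require Import all_boot all_order all_algebra.

Set Implicit Arguments.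
Unset Strict Implicit.
Unset Printing Implicit Defensive.

Import GRing.Theory.

(* A finite simple graph on the vertex type T is given by its adjacency       *)
(* relation e : rel T, assumed symmetric and irreflexive.                     *)

Section Graphs.

Variables (T : finType) (e : rel T).

Definition connected_graph : Prop :=
  0 < #|T| /\ forall x y : T, connect e x y.

Definition regular_graph : Prop :=
  exists k : nat, forall x : T, #|[set y | e x y]| = k.

Definition graph_cycle (c : seq T) : Prop := 2 < size c /\ ucycle e c.

(* Holds for no g when there is no odd cycle (infinite odd-girth).            *)
Definition is_odd_girth (g : nat) : Prop :=
  (exists c : seq T, [/\ graph_cycle c, odd (size c) & size c = g]) /\
  (forall c : seq T, graph_cycle c -> odd (size c) -> g <= size c).

Definition walk_of_length (x y : T) (k : nat) : bool :=
  [exists p : k.-tuple T, path e x p && (last x p == y)].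

(* The least length of a walk from x to y: a shortest walk repeats no vertex, *)
(* hence has length less than #|T|. The value is #|T| when no walk exists.    *)
Definition dist (x y : T) : nat := find (walk_of_length x y) (iota 0 #|T|).

Definition diameter : nat := \max_(x : T) \max_(y : T) dist x y.

Definition distance_regular : Prop :=
  connected_graph /\
  exists p : nat -> nat -> nat -> nat,
    forall h i j : nat, h <= diameter -> i <= diameter -> j <= diameter ->
    forall u v : T, dist u v = h ->
      #|[set w | (dist u w == i) && (dist v w == j)]| = p h i j.

Definition generalized_odd_graph : Prop :=
  distance_regular /\ is_odd_girth (2 * diameter + 1).

Definition adjacency_matrix (R : pzSemiRingType) : 'M[R]_#|T| :=
  \matrix_(i, j) (e (enum_val i) (enum_val j))%:R%R.

Lemma dist_le_path (x : T) (p : seq T) :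
  path e x p -> dist x (last x p) <= size p.
Proof.
move=> xp; rewrite /dist.
have [ltpT|leTp] := ltnP (size p) #|T|; last first.
  by apply: leq_trans leTp; rewrite -[leqRHS](size_iota 0) find_size.
rewrite leqNgt; apply/negP => /(before_find 0).
rewrite nth_iota // add0n => /existsP[]; exists (in_tuple p).
by rewrite xp eqxx.
Qed.

Lemma dist_path (x y : T) : connect e x y ->
  exists p : seq T, [/\ path e x p, last x p = y & size p = dist x y].
Proof.
case/connectP => q xq ->; case/shortenP: xq => p xp uniqp _.
have ltpT : size p < #|T|.
  by have := max_card (mem (x :: p)); rewrite (card_uniqP uniqp).
have has_w : has (walk_of_length x (last x p)) (iota 0 #|T|).
  apply/hasP; exists (size p); first by rewrite mem_iota.
  by apply/existsP; exists (in_tuple p); rewrite xp eqxx.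
have := nth_find 0 has_w; rewrite has_find size_iota in has_w.
rewrite nth_iota // add0n => /existsP[r /andP[xr /eqP lastr]].
by exists r; rewrite size_tuple.
Qed.

End Graphs.

Definition num_distinct_eigenvalues (F : fieldType) (n : nat) (A : 'M[F]_n)
    (m : nat) : Prop :=
  exists s : seq F,
    [/\ uniq s, size s = m & forall a : F, (a \in s) = eigenvalue A a].

(* Main.v *)
(* Write [A] for the adjacency matrix. By the odd-girth hypothesis two vertices
   at distance [h] are joined by no walk of length [l <= d] with [l - h] odd, and
   [h <= d] because Hoffman's polynomial, of degree [d], maps [A] to the all-ones
   matrix. Hence splitting a polynomial of degree at most [d] in [A] by the parity
   of the exponents is the same as splitting the matrix by the parity of the
   distance. Applied to the minimal polynomial (of degree [d + 1]), this yields a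
   nonzero polynomial in [A] supported on the pairs at distance exactly [d]. A
   polynomial [Z] of degree [k] in [A] that is supported on distance [k] is
   proportional to the distance-[k] matrix [A_k], as one sees by cancelling the
   leading term of the polynomial giving [A_0 + ... + A_k] against that of [Z].
   Descending from [k = d], the next [Z] is the part of parity [k - 1] of [A A_k],
   after cancelling its leading term against that of [A_(k+1)]. So every [A_k] is a
   polynomial of degree [k] in [A], and products [A_i A_j] are combinations of the
   [A_k], which is distance-regularity. *)

Require Import Defs.
From mathcomp Require Import all_boot all_order all_algebra zify.

Set Implicit Arguments.
Unset Strict Implicit.
Unset Printing Implicit Defensive.

Import GRing.Theory Num.Theory.

(** * Walks, distances and odd cycles *)

Section Walks.

Variables (T : finType) (e : rel T).
Hypotheses (e_sym : symmetric e) (e_irr : irreflexive e).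
Hypothesis e_conn : connected_graph e.

Local Notation walk := (walk_of_length e).
Local Notation dist := (dist e).

Lemma walkP x y k :
  reflect (exists p, [/\ path e x p, last x p = y & size p = k]) (walk x y k).
Proof.
apply: (iffP existsP) => [[p /andP[xp /eqP <-]]|[p [xp <- <-]]].
  by exists p; rewrite size_tuple.
by exists (in_tuple p); rewrite xp eqxx.
Qed.

Lemma walk0 x y : walk x y 0 = (x == y).
Proof.
apply/walkP/eqP => [[p [_ <- /size0nil ->]] //|->].
by exists [::].
Qed.

Lemma walkS x y k : walk x y k.+1 = [exists w, e x w && walk w y k].
Proof.
apply/walkP/existsP => [[[|w p] [] //= /andP[xw wp] lp [sp]]|].
  by exists w; rewrite xw; apply/walkP; exists p.
move=> [w /andP[xw /walkP[p [wp lp sp]]]].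
by exists (w :: p); rewrite /= xw wp sp.
Qed.

Lemma walk_cat x y z k l : walk x y k -> walk y z l -> walk x z (k + l).
Proof.
move=> /walkP[p [xp <- <-]] /walkP[q [yq <- <-]]; apply/walkP; exists (p ++ q).
by rewrite cat_path xp yq last_cat size_cat.
Qed.

Lemma walk_sym x y k : walk x y k = walk y x k.
Proof.
suff impl a b : walk a b k -> walk b a k by apply/idP/idP; apply: impl.
move=> /walkP[p [ap <- <-]]; apply/walkP; exists (rev (belast a p)).
rewrite rev_path size_rev size_belast; split=> //.
  by rewrite (eq_path (e' := e)) // => u v; rewrite e_sym.
by case: p ap => [//|w p] _; rewrite /= rev_cons last_rcons.
Qed.

(** Strong induction on the length: a repeated vertex splits the closed walk into two shorter ones,
    and one of them has odd length. *)
Lemma odd_closed_path_odd_cycle c : cycle e c -> odd (size c) ->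
  exists c', [/\ graph_cycle e c', odd (size c') & size c' <= size c].
Proof.
have [m] := ubnP (size c); elim: m c => // m IHm c; rewrite ltnS => le_cm c_cyc c_odd.
have [c_uniq|] := boolP (uniq c).
  exists c; split=> //; split; last by rewrite /ucycle c_cyc.
  (* Odd length rules out 0 and 2, irreflexivity rules out 1. *)
  by case: c c_cyc c_odd {le_cm c_uniq} => [|x [|y [|z c]]] //=; rewrite e_irr.
case: c c_cyc c_odd le_cm => // x0 c' + + + /(uniqPn x0)[i [j [lt_ij lt_j eq_ij]]].
move: (x0 :: c') lt_j eq_ij => c lt_j eq_ij c_cyc c_odd le_cm.
have lt_i := ltn_trans lt_ij lt_j.
have := drop_nth x0 lt_i; set x := nth x0 c i in eq_ij * => def_drop.
have x_in : x \in drop i.+1 c.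
  rewrite eq_ij -(subnKC lt_ij) -nth_drop mem_nth //.
  by rewrite size_drop ltn_sub2r // (leq_ltn_trans _ lt_j).
(* Rotated to start at the repeated vertex, the walk reads [x :: p1 ++ x :: p2]; its two pieces are
   the closed walks [x :: p1] and [x :: p2]. *)
have := size_rot i c; move: c_cyc; rewrite -(rot_cycle i) /rot def_drop cat_cons.
case/splitPr: x_in => p1 p2; rewrite -catA cat_cons.
move: (p2 ++ _) => {}p2; rewrite /= rcons_cat rcons_cons cat_path /=.
rewrite size_cat /= => /and3P[xp1 e1 xp2] sz.
have c1 : cycle e (x :: p1) by rewrite /= rcons_path xp1.
have c2 : cycle e (x :: p2) by [].
have sz' : size (x :: p1) + size (x :: p2) = size c by rewrite -sz /= addSn.
have [odd1|even1] := boolP (odd (size (x :: p1))).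
  have lt1 : size (x :: p1) < size c by rewrite -sz' -[ltnLHS]addn0 ltn_add2l.
  have [|c3 [? ? le3]] := IHm _ _ c1 odd1; first exact: leq_trans lt1 le_cm.
  by exists c3; split=> //; apply: leq_trans le3 (ltnW lt1).
have lt2 : size (x :: p2) < size c by rewrite -sz' -[ltnLHS]add0n ltn_add2r.
have [||c3 [? ? le3]] := IHm _ _ c2; first exact: leq_trans lt2 le_cm.
  by move: c_odd; rewrite -sz' oddD (negPf even1).
by exists c3; split=> //; apply: leq_trans le3 (ltnW lt2).
Qed.

Lemma odd_closed_walk_odd_cycle x k : walk x x k -> odd k ->
  exists c, [/\ graph_cycle e c, odd (size c) & size c <= k].
Proof.
case/walkP; case/lastP => [[_ _ <-] //|p y] [xp].
rewrite last_rcons size_rcons => yx <- oddk; rewrite yx in xp.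
exact: (@odd_closed_path_odd_cycle (x :: p)).
Qed.

Lemma dist_walk x y : walk x y (dist x y).
Proof. by apply/walkP; apply: dist_path; apply: e_conn.2. Qed.

Lemma dist_leq_walk x y k : walk x y k -> dist x y <= k.
Proof. by case/walkP => p [xp <- <-]; apply: dist_le_path. Qed.

Lemma dist_xx x : dist x x = 0.
Proof. by apply/eqP; rewrite -leqn0 dist_leq_walk // walk0. Qed.

Lemma dist_sym x y : dist x y = dist y x.
Proof.
by apply/eqP; rewrite eqn_leq !dist_leq_walk // walk_sym dist_walk.
Qed.

Lemma dist_pred x y h : dist x y = h.+1 -> exists2 w, e x w & dist w y = h.
Proof.
move=> xy; have := dist_walk x y; rewrite xy walkS => /existsP[w /andP[xw wy]].
exists w => //; apply/eqP; rewrite eqn_leq dist_leq_walk // -ltnS -xy.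
by apply: dist_leq_walk; rewrite walkS; apply/existsP; exists w; rewrite xw dist_walk.
Qed.

Lemma dist_edge x w y : e x w -> dist x y <= (dist w y).+1.
Proof.
move=> xw; apply: dist_leq_walk; rewrite walkS; apply/existsP; exists w.
by rewrite xw dist_walk.
Qed.

(** A geodesic from [y] back to [x] completes the walk to a closed walk of odd length
    [k + dist x y]. *)
Lemma leq_odd_walk_dist g x y k :
  (forall c, graph_cycle e c -> odd (size c) -> g <= size c) ->
  walk x y k -> odd k != odd (dist x y) -> g <= k + dist x y.
Proof.
move=> gP xyk odd_neq.
have xxw : walk x x (k + dist x y) by apply: walk_cat xyk _; rewrite walk_sym dist_walk.
have [|c [? ? le_c]] := odd_closed_walk_odd_cycle xxw.
  by rewrite oddD; case: odd odd_neq; case: odd.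
by apply: leq_trans le_c; apply: gP.
Qed.

(** Otherwise the distance to [x] changes by exactly one along every edge, so its parity alternates,
    which is impossible around an odd cycle. *)
Lemma odd_cycle_equidistant_edge c x : graph_cycle e c -> odd (size c) ->
  exists u v, e u v /\ dist u x = dist v x.
Proof.
move=> [_ /andP[c_cyc _]] c_odd.
have [/existsP[u /existsP[v /andP[uv /eqP eq_uv]]]|noedge] :=
  boolP [exists u, exists v, e u v && (dist u x == dist v x)].
  by exists u, v.
have flip u v : e u v -> odd (dist v x) = ~~ odd (dist u x).
  move=> uv; have := dist_edge x uv; have := dist_edge x (etrans (e_sym v u) uv).
  have : dist u x != dist v x.
    apply: contra noedge => ?.
    by apply/existsP; exists u; apply/existsP; exists v; apply/andP.
  rewrite neq_ltn => /orP[lt_uv le_vu _|lt_vu _ le_uv].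
    by have/eqP -> : dist v x == (dist u x).+1 by rewrite eqn_leq lt_uv le_vu.
  have/eqP -> : dist u x == (dist v x).+1 by rewrite eqn_leq lt_vu le_uv.
  by rewrite /= negbK.
have path_odd u p : path e u p -> odd (dist (last u p) x) = odd (size p) (+) odd (dist u x).
  elim: p u => //= v p IHp u /andP[uv /IHp ->]; rewrite (flip u v uv).
  by case: odd; case: odd.
case: c c_cyc c_odd => // y c /= c_cyc c_odd.
have := path_odd _ _ c_cyc; rewrite last_rcons size_rcons /= c_odd.
by case: odd.
Qed.

End Walks.

(** * Polynomials evaluated at a matrix *)

Section MatrixPolynomials.

Local Open Scope ring_scope.

Lemma horner_mxE (R : comNzRingType) n (A : 'M[R]_n.+1) (q : {poly R}) i j :
  horner_mx A q i j = \sum_(k < size q) q`_k * (A ^+ k) i j.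
Proof.
rewrite -{1}[q]coefK poly_def rmorph_sum summxE; apply: eq_bigr => k _ /=.
by rewrite horner_mxZ rmorphXn /= horner_mx_X mxE.
Qed.

Lemma horner_mx_eigenvector (F : fieldType) n (A : 'M[F]_n.+1) (v : 'rV_n.+1) a q :
  v *m A = a *: v -> v *m horner_mx A q = q.[a] *: v.
Proof.
move=> vA; elim/poly_ind: q => [|q c IHq]; first by rewrite rmorph0 mulmx0 horner0 scale0r.
rewrite rmorphD rmorphM /= horner_mx_X horner_mx_C mulmxDr.
rewrite -[_ * A]/(_ *m A) mulmxA IHq -scalemxAl vA scalerA mul_mx_scalar.
by rewrite -scalerDl !hornerE.
Qed.

(** Unitary diagonalisation reduces the claim to the diagonal entries. These are eigenvalues, with
    the rows of [P] as eigenvectors, hence roots of the product. *)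
Lemma normalmx_horner_prod_eigenvalues (C : numClosedFieldType) n (A : 'M[C]_n.+1)
    (s : seq C) : A \is spectral.normalmx -> {subset eigenvalue A <= s} ->
  horner_mx A (\prod_(a <- s) ('X - a%:P)) = 0.
Proof.
move=> /spectral.orthomx_spectralP defA sP.
set P := spectral.spectralmx A in defA; set D := spectral.spectral_diag A in defA.
have P_unit : P \in unitmx := spectral.spectral_unit A.
rewrite defA horner_mx_uconjC // horner_mx_diag.
suff -> : map_mx (horner (\prod_(a <- s) ('X - a%:P))) D = 0.
  by rewrite linear0 mulmx0 mul0mx.
apply/matrixP => z i; rewrite !mxE ord1; apply/eqP.
rewrite -rootE root_prod_XsubC; apply/sP/eigenvalueP; exists (row i P).
  rewrite -row_mul {1}defA !mulmxA mulmxV // mul1mx row_mul row_diag_mx.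
  by rewrite -scalemxAl -rowE.
apply/eqP => Pi0; have := congr1 (fun M => M *m invmx P) Pi0.
rewrite mul0mx -row_mul mulmxV // => /matrixP/(_ 0 i)/eqP.
by rewrite !mxE eqxx oner_eq0.
Qed.

(** * Splitting a polynomial by the parity of its exponents *)

Definition parity_part (R : nzSemiRingType) (b : bool) (q : {poly R}) : {poly R} :=
  \poly_(k < size q) (if odd k == b then q`_k else 0).

Lemma coef_parity_part (R : nzSemiRingType) b (q : {poly R}) k :
  (parity_part b q)`_k = if odd k == b then q`_k else 0.
Proof.
by rewrite coef_poly; case: ltnP => // /(nth_default 0) ->; case: ifP.
Qed.

Lemma size_parity_part (R : nzSemiRingType) b (q : {poly R}) :
  (size (parity_part b q) <= size q)%N.
Proof. exact: size_poly. Qed.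

Lemma size_parity_part_drop (R : nzSemiRingType) b (q : {poly R}) m :
  (size q <= m.+1)%N -> odd m != b -> (size (parity_part b q) <= m)%N.
Proof.
move=> le_qm odd_m; apply/leq_sizeP => k le_mk; rewrite coef_parity_part.
case: eqP => // odd_k; apply: nth_default; apply: leq_trans le_qm _.
rewrite ltn_neqAle le_mk andbT; apply: contra_neq odd_m => -> //.
Qed.

Lemma parity_partD (R : nzSemiRingType) b (q : {poly R}) :
  q = parity_part b q + parity_part (~~ b) q.
Proof.
apply/polyP => k; rewrite coefD !coef_parity_part.
by case: odd; case: b; rewrite /= ?addr0 ?add0r.
Qed.

Lemma horner_mx_parity_part0 (R : comNzRingType) n (A : 'M[R]_n.+1) (q : {poly R}) b i j :
  (forall k, (k < size q)%N -> odd k = b -> (A ^+ k) i j = 0) ->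
  horner_mx A (parity_part b q) i j = 0.
Proof.
move=> A0; rewrite horner_mxE big1 // => k _; rewrite coef_parity_part.
case: eqP => [odd_k|]; last by rewrite mul0r.
by rewrite A0 ?mulr0 // (leq_trans (ltn_ord k)) // size_parity_part.
Qed.

End MatrixPolynomials.

(** * Powers of the adjacency matrix and walks *)

Section RegularConnected.

Local Open Scope ring_scope.

Variables (C : numClosedFieldType) (T : finType) (e : rel T).
Hypothesis e_sym : symmetric e.
Hypothesis e_conn : connected_graph e.
Variables (n : nat) (f : 'I_n.+1 -> T).
Hypothesis f_bij : bijective f.

Local Notation A := (\matrix_(i, j) (e (f i) (f j))%:R : 'M[C]_n.+1).
Local Notation walk := (walk_of_length e).
Local Notation dist i j := (dist e (f i) (f j)).

Lemma adjacency_sym : A^T = A.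
Proof. by apply/matrixP => i j; rewrite !mxE e_sym. Qed.

Lemma adjacency_normal : A \is spectral.normalmx.
Proof.
apply: spectral.hermitian_normalmx; apply/sesquilinear.is_hermitianmxP.
rewrite expr0 scale1r adjacency_sym; apply/matrixP => i j.
by rewrite !mxE conjC_nat.
Qed.

Lemma adjacency_expE k i j : (A ^+ k.+1) i j = \sum_w (e (f i) (f w))%:R * (A ^+ k) w j.
Proof. by rewrite exprS -[_ * _]/(_ *m _) mxE; apply: eq_bigr => w _; rewrite mxE. Qed.

Lemma adjacency_exp_ge0 k i j : 0 <= (A ^+ k) i j.
Proof.
elim: k i j => [|k IHk] i j; first by rewrite expr0 mxE ler0n.
by rewrite adjacency_expE sumr_ge0 // => w _; rewrite mulr_ge0 ?ler0n.
Qed.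

(** All terms are nonnegative, so nothing cancels and a single walk makes the entry nonzero. *)
Lemma adjacency_exp_neq0 k i j : ((A ^+ k) i j != 0) = walk (f i) (f j) k.
Proof.
elim: k i => [|k IHk] i.
  rewrite expr0 mxE walk0 (bij_eq f_bij). by rewrite pnatr_eq0 eqb0 negbK.
rewrite adjacency_expE walkS psumr_neq0; last first.
  by move=> w _; rewrite mulr_ge0 ?ler0n ?adjacency_exp_ge0.
have lt0E w : (0 < (e (f i) (f w))%:R * (A ^+ k) w j) = e (f i) (f w) && walk (f w) (f j) k.
  rewrite lt0r mulr_ge0 ?ler0n ?adjacency_exp_ge0 // andbT mulf_eq0 negb_or IHk.
  by rewrite pnatr_eq0; case: (e _ _).
apply/hasP/existsP => [[w _]|[y]]; first by rewrite /= lt0E; exists (f w).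
have [g gK fK] := f_bij.
by rewrite -(fK y) => ?; exists (g y); rewrite ?mem_index_enum //= lt0E.
Qed.

Lemma exp_supp k i j : (k < dist i j)%N -> (A ^+ k) i j = 0.
Proof.
move=> lt_k; apply/eqP; apply: contraLR lt_k; rewrite adjacency_exp_neq0 -leqNgt.
exact: dist_leq_walk.
Qed.

(** * Hoffman's polynomial of a connected regular graph *)

Variable k : nat.
Hypothesis e_reg : forall x, #|[set y | e x y]| = k.

Lemma row_sum_adjacency i : \sum_j A i j = k%:R.
Proof.
rewrite -(e_reg (f i)) -sum1dep_card natr_sum [RHS]big_mkcond /=.
rewrite [RHS](reindex f) /=; last exact: onW_bij.
by apply: eq_bigr => j _; rewrite mxE; case: (e _ _).
Qed.

(** The Laplacian quadratic form, a sum of [|v i - v j|^2] over adjacent pairs, vanishes at [v]; so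
    [v] is constant along edges, and connectedness does the rest. *)
Lemma adjacency_eigenvector_const (v : 'cV[C]_n.+1) : A *m v = k%:R *: v ->
  forall i j, v i 0 = v j 0.
Proof.
move=> Av.
have Av0 i : \sum_j A i j * (v i 0 - v j 0) = 0.
  under eq_bigr do rewrite mulrBr; rewrite sumrB -mulr_suml row_sum_adjacency.
  by have /matrixP/(_ i 0) := Av; rewrite !mxE => <-; rewrite subrr.
have S0 : \sum_i \sum_j A i j * ((v i 0 - v j 0) * (v i 0 - v j 0)^*) = 0.
  (* Expanding the conjugate gives two sums that become equal after exchanging [i] and [j], by
     symmetry of [A]. *)
  transitivity (\sum_i ((\sum_j A i j * (v i 0 - v j 0)) * (v i 0)^*
                  + (\sum_j A i j * (v i 0 - v j 0)) * (v i 0)^*)); last first.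
    by rewrite big1 // => i _; rewrite Av0 mul0r addr0.
  rewrite [RHS]big_split /=.
  under [X in _ = _ + X]eq_bigr do rewrite mulr_suml.
  rewrite [X in _ = _ + X]exchange_big -big_split /=; apply: eq_bigr => i _.
  rewrite mulr_suml -big_split /=; apply: eq_bigr => j _.
  rewrite ![A _ _]mxE e_sym rmorphB /= -!mulrA -mulrDr; congr (_ * _).
  by rewrite mulrBr -[in RHS](opprB (v i 0)) mulNr.
have edge x y : e (f x) (f y) -> v x 0 = v y 0.
  move=> xy; have ge0 i j : 0 <= A i j * ((v i 0 - v j 0) * (v i 0 - v j 0)^*).
    by rewrite mulr_ge0 ?mul_conjC_ge0 // mxE ler0n.
  have := psumr_eq0P (fun i _ => sumr_ge0 _ (fun j _ => ge0 i j)) S0 (i := x) isT.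
  move=> /(psumr_eq0P (fun j _ => ge0 x j))/(_ y isT)/eqP.
  by rewrite mxE xy mul1r mul_conjC_eq0 subr_eq0 => /eqP.
have [g fK gK] := f_bij => i j.
have /connectP[p ip lastp] := e_conn.2 (f i) (f j).
rewrite -[j]fK {}lastp; elim: p i ip => [|y p IHp] i /=; first by rewrite fK.
by case/andP => iy py; rewrite (edge i (g y)) ?gK // IHp gK.
Qed.

Variables (d : nat) (s : seq C).
Hypotheses (s_uniq : uniq s) (size_s : size s = d.+1).
Hypothesis s_eig : forall a, (a \in s) = eigenvalue A a.

Local Notation minpoly := (\prod_(a <- s) ('X - a%:P)).

Lemma horner_minpoly : horner_mx A minpoly = 0.
Proof.
by apply: normalmx_horner_prod_eigenvalues adjacency_normal _ => a; rewrite s_eig.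
Qed.

(** With [h] the product over the eigenvalues other than the valency [k], [h(A)] is annihilated by
    [A - k]. Its columns, and by symmetry its rows, are therefore constant, so it is a multiple of
    the all-ones matrix. *)
Lemma horner_all_ones :
  exists2 q : {poly C}, (size q <= d.+1)%N & horner_mx A q = const_mx 1.
Proof.
pose one : 'rV[C]_n.+1 := const_mx 1.
have oneA : one *m A = k%:R *: one.
  apply/rowP => j; rewrite -[in LHS]adjacency_sym !mxE -(row_sum_adjacency j) mulr1.
  by apply: eq_bigr => i _; rewrite !mxE mul1r.
have k_s : k%:R \in s.
  rewrite s_eig; apply/eigenvalueP; exists one => //; apply/eqP => /rowP/(_ 0)/eqP.
  by rewrite !mxE oner_eq0.
pose h : {poly C} := \prod_(a <- rem k%:R s) ('X - a%:P).
have sizeh : size h = d.+1 by rewrite size_prod_XsubC size_rem ?size_s.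
have hk : h.[k%:R] != 0 by rewrite -rootE root_prod_XsubC mem_rem_uniq // !inE eqxx.
have defm : minpoly = ('X - k%:R%:P) * h.
  by rewrite (perm_big _ (perm_to_rem k_s)) big_cons.
set X := horner_mx A h.
have AX : A *m X = k%:R *: X.
  have := horner_minpoly; rewrite defm rmorphM rmorphB /= horner_mx_X horner_mx_C.
  rewrite mulrBl => /eqP; rewrite subr_eq0 -/X => /eqP AX.
  by rewrite -[LHS]/(A * X) AX -[LHS]/(_ *m _) mul_scalar_mx.
have XA : X *m A = k%:R *: X by rewrite -AX; apply: comm_horner_mx.
have X_col i i' j : X i j = X i' j.
  have := @adjacency_eigenvector_const (col j X); rewrite {1 2}colE mulmxA AX.
  by rewrite -scalemxAl => /(_ erefl i i'); rewrite !mxE.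
have X_row i j j' : X i j = X i j'.
  have := @adjacency_eigenvector_const (row i X)^T.
  rewrite -{1}adjacency_sym -trmx_mul -row_mul XA !linearZ /= => /(_ erefl j j').
  by rewrite !mxE.
have X0 : X 0 0 != 0.
  (* The all-ones row is an eigenvector of [X] for the nonzero value [h(k)]. *)
  apply: contra_neq hk => X0; have /rowP/(_ 0) := horner_mx_eigenvector h oneA.
  rewrite !mxE mulr1 => <-; rewrite big1 // => i _.
  by rewrite -/X (X_col _ 0) X0 mulr0.
exists ((X 0 0)^-1 *: h); first by rewrite (leq_trans (size_scale_leq _ _)) ?sizeh.
rewrite horner_mxZ; apply/matrixP => i j.
by rewrite mxE -/X (X_col _ 0) (X_row _ _ 0) !mxE mulVf.
Qed.

Lemma dist_leq_spectrum i j : (dist i j <= d)%N.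
Proof.
have [q size_q defJ] := horner_all_ones; rewrite leqNgt; apply/negP => lt_d.
have /eqP := congr1 (fun M : 'M_n.+1 => M i j) defJ.
rewrite horner_mxE big1 ?mxE 1?eq_sym ?oner_eq0 // => m _.
by rewrite exp_supp ?mulr0 // (leq_trans (ltn_ord m)) // (leq_trans size_q).
Qed.

End RegularConnected.

(** * Polynomials in the adjacency matrix under the odd-girth bound *)

Section DistanceMatrices.

Local Open Scope ring_scope.

Variables (C : numClosedFieldType) (T : finType) (e : rel T).
Hypotheses (e_sym : symmetric e) (e_irr : irreflexive e).
Hypothesis e_conn : connected_graph e.
Variables (n : nat) (f : 'I_n.+1 -> T).
Hypothesis f_bij : bijective f.

Local Notation A := (\matrix_(i, j) (e (f i) (f j))%:R : 'M[C]_n.+1).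
Local Notation dist i j := (dist e (f i) (f j)).

Variables (d : nat) (m : {poly C}).
Hypotheses (m_monic : m \is monic) (size_m : size m = d.+2).
Hypothesis m_A : horner_mx A m = 0.
Hypothesis all_ones_A :
  exists2 q : {poly C}, (size q <= d.+1)%N & horner_mx A q = const_mx 1.
Hypothesis dist_le_d : forall i j, (dist i j <= d)%N.
Hypothesis odd_cycle_ge :
  forall c, graph_cycle e c -> odd (size c) -> (2 * d + 1 <= size c)%N.
Hypothesis has_odd_cycle : exists2 c, graph_cycle e c & odd (size c).

(** A walk of length [k] would close up to an odd cycle of length at most [2 * d]. *)
Lemma exp_parity k i j :
  (k + dist i j <= 2 * d)%N -> odd k != odd (dist i j) -> (A ^+ k) i j = 0.
Proof.
move=> le_2d odd_k; apply/eqP; apply: contraLR le_2d.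
rewrite adjacency_exp_neq0 // -ltnNge => ijk; rewrite -addn1.
exact: (leq_odd_walk_dist e_sym e_irr e_conn odd_cycle_ge ijk).
Qed.

(** The bound is on the size: [V k] consists of the polynomials in [A] of degree less than [k]. *)
Definition poly_of_adjacency (k : nat) (X : 'M[C]_n.+1) :=
  exists2 q : {poly C}, (size q <= k)%N & X = horner_mx A q.

Local Notation V := poly_of_adjacency.

Lemma V_supp k X i j : V k X -> (k <= dist i j)%N -> X i j = 0.
Proof.
case=> q le_qk -> le_k; rewrite horner_mxE big1 // => l _.
rewrite exp_supp ?mulr0 // (leq_trans (ltn_ord l)) //.
exact: leq_trans le_qk le_k.
Qed.

Lemma V_mul_adjacency k X : V k X -> V k.+1 (A *m X).
Proof.
move=> [q sq ->]; exists ('X * q); last by rewrite rmorphM /= horner_mx_X.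
by rewrite (leq_trans (size_polyMleq _ _)) // size_polyX.
Qed.

Lemma V_mul_reduce k l X Y : V k X -> V l Y -> V d.+1 (X *m Y).
Proof.
move=> [q _ ->] [r _ ->]; exists ((q * r) %% m).
  by rewrite -ltnS -size_m ltn_modp monic_neq0.
by rewrite -[LHS]rmorphM {1}(divp_eq (q * r) m) rmorphD rmorphM /= m_A mulr0 add0r.
Qed.

(** A polynomial of degree below [k] vanishes at distance [k], so the nonzero entry forces a nonzero
    coefficient of degree [k] in [X], which can cancel that of [Y]. *)
Lemma V_subtract_top k X Y i j : V k.+1 X -> V k.+1 Y ->
  dist i j = k -> X i j != 0 -> exists c, V k (Y - c *: X).
Proof.
move=> VX [r sr defY] distij Xij; have [q sq defX] := VX.
have size_drop (p : {poly C}) : (size p <= k.+1)%N -> p`_k = 0 -> (size p <= k)%N.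
  move=> /leq_sizeP p0 pk; apply/leq_sizeP => l; rewrite leq_eqVlt => /predU1P[<- //|].
  exact: p0.
have qk : q`_k != 0.
  apply: contra_neq Xij => qk.
  have VkX : V k X by exists q; rewrite ?size_drop.
  by rewrite (V_supp VkX) ?distij.
exists (r`_k / q`_k); exists (r - (r`_k / q`_k) *: q).
  apply: size_drop; last by rewrite coefB coefZ divfK ?subrr.
  rewrite (leq_trans (size_polyD _ _)) // geq_max sr size_polyN.
  by rewrite (leq_trans (size_scale_leq _ _)).
by rewrite rmorphB /= horner_mxZ defX defY.
Qed.

(** Exponents and distances are both at most [d], so [exp_parity] kills every power whose parity
    differs from that of the distance. *)
Lemma horner_parity_part (q : {poly C}) b i j : (size q <= d.+1)%N ->
  horner_mx A (parity_part b q) i j =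
    if odd (dist i j) == b then horner_mx A q i j else 0.
Proof.
move=> sq.
have vanish c : odd (dist i j) != c -> horner_mx A (parity_part c q) i j = 0.
  move=> odd_ij; apply: horner_mx_parity_part0 => k lt_k odd_k.
  apply: exp_parity; last by rewrite odd_k eq_sym.
  by rewrite mul2n -addnn leq_add // -ltnS (leq_trans lt_k).
case: ifPn => [/eqP odd_ij|]; last exact: vanish.
rewrite [in RHS](parity_partD b q) rmorphD /= mxE (vanish (~~ b)) ?addr0 //.
by rewrite odd_ij; case: b {odd_ij}.
Qed.

(** * A nonzero matrix supported on distance exactly [d] *)

Local Notation topmx := (horner_mx A (parity_part (odd d) m)).

Lemma V_topmx : V d.+1 topmx.
Proof.
exists (parity_part (odd d) m) => //; apply: size_parity_part_drop.
  by rewrite size_m.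
by rewrite /=; case: odd.
Qed.

Lemma topmx_opp : topmx = - horner_mx A (parity_part (~~ odd d) m).
Proof. by apply/eqP; rewrite -addr_eq0 -rmorphD -parity_partD /= m_A. Qed.

(** Exponents up to [d + 1] and distances up to [d - 1] add up to at most [2 * d]. Of the two
    expressions for [topmx], one uses only exponents of parity opposite to the distance, and all
    those powers vanish. *)
Lemma topmx_supp i j : dist i j != d -> topmx i j = 0.
Proof.
move=> neq_d; have lt_d : (dist i j < d)%N by rewrite ltn_neqAle neq_d dist_le_d.
have [odd_ij|odd_ij] := eqVneq (odd (dist i j)) (odd d).
  rewrite topmx_opp mxE horner_mx_parity_part0 ?oppr0 // => k; rewrite size_m => lt_k odd_k.
  apply: exp_parity; first by lia.
  by rewrite odd_k odd_ij; case: odd.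
apply: horner_mx_parity_part0 => k; rewrite size_m => lt_k odd_k.
apply: exp_parity; last by rewrite odd_k eq_sym.
have : k != d.+1 by apply/eqP => defk; move: odd_k; rewrite defk /=; case: odd.
by lia.
Qed.

(* Otherwise the part of [m] of parity [d + 1] annihilates [A], so all powers
   of odd exponent have zero diagonal and the graph is bipartite. *)
Lemma topmx_neq0 : exists i j, topmx i j != 0.
Proof.
have [/existsP[i /existsP[j topij]]|no_top] := boolP [exists i, exists j, topmx i j != 0].
  by exists i, j.
pose r := parity_part (~~ odd d) m.
have rA : horner_mx A r = 0.
  rewrite -[horner_mx A r]opprK -topmx_opp; apply/matrixP => i j.
  rewrite !mxE; apply/eqP; rewrite oppr_eq0; apply: contraNT no_top => topij.
  by apply/existsP; exists i; apply/existsP; exists j.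
have rd : r`_d.+1 = 1.
  by rewrite coef_parity_part /= eqxx; move/monicP: m_monic; rewrite lead_coefE size_m.
have diag0 k i : odd k -> (A ^+ k) i i = 0.
  have [l] := ubnP k; elim: l k => // l IHl k; rewrite ltnS => le_kl odd_k.
  have [le_k2d|lt_2dk] := leqP k (2 * d).
    by apply: exp_parity; rewrite dist_xx // ?addn0 // odd_k.
  (* Since [r] is monic of degree [d + 1] with all exponents of that parity, reducing ['X^k] by it
     leaves only smaller exponents of the parity of [k]. *)
  pose p : {poly C} := 'X^(k - d.+1) * (r - 'X^(d.+1)).
  have le_dk : (d.+1 <= k)%N by lia.
  have -> : A ^+ k = - horner_mx A p.
    rewrite /p mulrBr -exprD subnK // rmorphB rmorphM /= rA mulr0 sub0r opprK.
    by rewrite rmorphXn /= horner_mx_X.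
  rewrite mxE horner_mxE big1 ?oppr0 // => -[h /= _] _.
  rewrite coefXnM coefB coef_parity_part coefXn.
  case: ltnP => [|le_h]; first by rewrite mul0r.
  have [->|neq] := eqVneq (h - (k - d.+1))%N d.+1.
    rewrite /= eqxx; move: rd; rewrite coef_parity_part /= eqxx => ->.
    by rewrite subrr mul0r.
  rewrite subr0; case: eqP => [odd_h|]; last by rewrite mul0r.
  have [lt_hk|le_kh] := ltnP h k; first by rewrite IHl ?mulr0 //; lia.
  rewrite nth_default ?mul0r // size_m; lia.
have [[|x c] [_ /andP[c_cyc _]] odd_c] := has_odd_cycle; first by [].
have [g fK gK] := f_bij.
have : walk_of_length e (f (g x)) (f (g x)) (size (x :: c)).
  by rewrite gK; apply/walkP; exists (rcons c x); rewrite last_rcons size_rcons.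
by rewrite -(adjacency_exp_neq0 C e f_bij) diag0 ?eqxx.
Qed.

(** A nonzero entry of [topmx] gives distance [d], and a geodesic passes through all smaller
    distances. *)
Lemma dist_attained k : (k <= d)%N -> exists i j, dist i j = k.
Proof.
move=> le_kd; rewrite -(subKn le_kd); elim: (d - k)%N (leq_subr k d) => [|l IHl] le_ld.
  have [i [j topij]] := topmx_neq0; exists i, j; apply/eqP; rewrite subn0.
  by apply: contraNT topij => /topmx_supp ->.
have [i [j distij]] := IHl (ltnW le_ld).
have [|w _ wj] := @dist_pred _ e e_conn (f i) (f j) (d - l.+1); first by rewrite distij; lia.
by have [g _ gK] := f_bij; exists (g w), j; rewrite gK.
Qed.

(** * Distance matrices as polynomials in the adjacency matrix *)

Definition distmx k : 'M[C]_n.+1 := \matrix_(i, j) (dist i j == k)%:R.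
(** The inequality is strict to match the indexing of [V]: the goal is [V k (ballmx k)]. *)
Definition ballmx k : 'M[C]_n.+1 := \matrix_(i, j) (dist i j < k)%:R.

(** Cancelling leading terms makes [ballmx k.+1 - c *: Z] vanish at distance [k], where the ball
    matrix is 1. Hence [c *: Z] is [distmx k] and the difference is [ballmx k]. *)
Lemma V_distmx_of_supp k Z i0 j0 : V k.+1 Z -> (forall i j, dist i j != k -> Z i j = 0) ->
  Z i0 j0 != 0 -> V k.+1 (ballmx k.+1) -> V k.+1 (distmx k) /\ V k (ballmx k).
Proof.
move=> VZ Z_supp Z0 Vball.
have dist0 : dist i0 j0 = k.
  by apply/eqP; apply: contraNT Z0 => /Z_supp ->.
have [c Vsub] := V_subtract_top VZ Vball dist0 Z0.
have defD : distmx k = c *: Z.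
  apply/matrixP => i j; rewrite !mxE; case: eqVneq => [distij|/Z_supp ->]; last by rewrite mulr0.
  have := V_supp (i := i) (j := j) Vsub; rewrite distij leqnn => /(_ isT)/eqP.
  by rewrite !mxE distij ltnSn subr_eq0 => /eqP.
rewrite -defD in Vsub; split.
  case: VZ defD => q sq -> ->; exists (c *: q); last by rewrite horner_mxZ.
  by rewrite (leq_trans (size_scale_leq _ _)).
suff -> : ballmx k = ballmx k.+1 - distmx k by [].
apply/matrixP => i j; rewrite !mxE ltnS [in RHS]leq_eqVlt.
by case: eqVneq => [->|_]; rewrite /= ?ltnn ?subrr ?subr0.
Qed.

Lemma adjacency_mul_distmxE k i j :
  (A *m distmx k) i j = \sum_w (e (f i) (f w) && (dist w j == k))%:R.
Proof. by rewrite mxE; apply: eq_bigr => w _; rewrite !mxE -natrM mulnb. Qed.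

Lemma V_distmx_ballmx k : (k <= d.+1)%N ->
  (forall l, (k <= l <= d)%N -> V l.+1 (distmx l)) /\ V k (ballmx k).
Proof.
(* Descending induction on [k] from [d.+1], where the ball matrix is the all-ones matrix. *)
move=> le_kd; rewrite -(subKn le_kd); elim: (d.+1 - k)%N (leq_subr k d.+1) => [|t IHt] le_td.
  rewrite subn0; split=> [l|]; first by lia.
  have [q sq defJ] := all_ones_A; exists q => //; rewrite defJ.
  by apply/matrixP => i j; rewrite !mxE ltnS dist_le_d.
have [VD VB] := IHt (ltnW le_td); rewrite subSS.
have def_l : (d.+1 - t = (d - t).+1)%N by rewrite subSn.
move: (d - t)%N (leq_subr t d) def_l => l le_ld def_l; rewrite {}def_l {IHt} in VD VB.
suff [Z [VZ Z_supp [i0 [j0 Z0]]]] : exists Z, [/\ V l.+1 Z,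
    forall i j, dist i j != l -> Z i j = 0 & exists i j, Z i j != 0].
  have [VDl VBl] := V_distmx_of_supp VZ Z_supp Z0 VB; split=> // l' /andP[le_l' le_d].
  by have [<- //|neq_l] := eqVneq l l'; apply: VD; rewrite ltn_neqAle neq_l le_l'.
have [->|neq_ld] := eqVneq l d.
  by exists topmx; split; [exact: V_topmx|exact: topmx_supp|exact: topmx_neq0].
have lt_ld : (l < d)%N by rewrite ltn_neqAle neq_ld.
(* The product [A *m distmx l.+1] is brought down to degree [l + 1] without changing entries at
   distance at most [l]: by reduction modulo [m] if [l + 1 = d], else by subtracting a multiple of
   [distmx l.+2]. *)
have [Y [VY defY]] : exists Y, V l.+2 Y /\
    forall i j, (dist i j <= l)%N -> Y i j = (A *m distmx l.+1) i j.
  have VDl : V l.+2 (distmx l.+1) by apply: VD; rewrite leqnn.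
  have [def_d|neq_d] := eqVneq l.+1 d.
    have VA : V 2 A by exists 'X; rewrite ?size_polyX ?horner_mx_X.
    exists (A *m distmx l.+1); split=> //.
    by have := V_mul_reduce VA VDl; rewrite -{1}def_d.
  have lt_l2d : (l.+2 <= d)%N by rewrite ltn_neqAle neq_d.
  have [i [j distij]] := dist_attained lt_l2d.
  have Dij : distmx l.+2 i j != 0 by rewrite mxE distij eqxx oner_eq0.
  have VDl2 : V l.+3 (distmx l.+2) by apply: VD; rewrite lt_l2d leqnSn.
  have [c VY] := V_subtract_top VDl2 (V_mul_adjacency VDl) distij Dij.
  exists (A *m distmx l.+1 - c *: distmx l.+2); split=> // i' j' le_l.
  have D0 : distmx l.+2 i' j' = 0 by rewrite mxE ltn_eqF //; lia.
  by rewrite mxE [X in _ + X]mxE [X in _ - X]mxE D0 mulr0 subr0.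
have [q sq defq] := VY.
have ZE i j : horner_mx A (parity_part (odd l) q) i j =
    if odd (dist i j) == odd l then Y i j else 0.
  by rewrite horner_parity_part ?defq // (leq_trans sq).
(* Exponent [l + 1] has the wrong parity, so the degree drops to [l]. *)
have VZ : V l.+1 (horner_mx A (parity_part (odd l) q)).
  by exists (parity_part (odd l) q) => //; apply: size_parity_part_drop; rewrite //=; case: odd.
exists (horner_mx A (parity_part (odd l) q)); split=> // [i j|].
  (* Beyond distance [l] the degree bound applies; below it, no neighbour of the first vertex lies
     at distance [l + 1] from the second. *)
  rewrite neq_ltn => /orP[lt_l|lt_l]; last exact: V_supp VZ lt_l.
  rewrite ZE; case: ifP => // _; rewrite defY ?(ltnW lt_l) // adjacency_mul_distmxE.
  rewrite big1 // => w _.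
  case: andP => // -[iw /eqP distw].
  have := dist_edge e_conn (f j) (etrans (e_sym _ _) iw); rewrite distw; lia.
(* The first edge of a geodesic of length [l + 1] gives a nonzero entry at distance [l]. *)
have [i [j distij]] := dist_attained lt_ld.
have [w iw distw] := dist_pred e_conn distij.
have [g fK gK] := f_bij; exists (g w), j.
rewrite ZE gK distw eqxx defY ?gK ?distw // adjacency_mul_distmxE psumr_neq0; last first.
  by move=> v _; rewrite ler0n.
by apply/hasP; exists i; rewrite ?mem_index_enum //= gK e_sym iw distij eqxx ltr01.
Qed.

(** Induction on the degree: a multiple of [distmx k], itself a function of the distance, removes
    the leading term. *)
Lemma V_dist_const k X i j i' j' : (k <= d.+1)%N -> V k X ->
  dist i j = dist i' j' -> X i j = X i' j'.
Proof.
elim: k X => [|k IHk] X le_kd VX eq_dist; first by rewrite !(V_supp VX).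
have [VD _] := V_distmx_ballmx (leq0n d.+1).
have [i0 [j0 dist0]] := dist_attained le_kd.
have D0 : distmx k i0 j0 != 0 by rewrite mxE dist0 eqxx oner_eq0.
have [c VY] := V_subtract_top (VD k le_kd) VX dist0 D0.
have := IHk _ (ltnW le_kd) VY eq_dist.
by rewrite !mxE eq_dist => /addIr.
Qed.

(** The count is an entry of [distmx a *m distmx b], a polynomial in [A] of degree at most [d] after
    reduction modulo [m]. *)
Lemma card_dist_const a b i j i' j' : (a <= d)%N -> (b <= d)%N -> dist i j = dist i' j' ->
  #|[set w | (Defs.dist e (f i) w == a) && (Defs.dist e (f j) w == b)]| =
  #|[set w | (Defs.dist e (f i') w == a) && (Defs.dist e (f j') w == b)]|.
Proof.
move=> le_ad le_bd eq_dist.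
have [VD _] := V_distmx_ballmx (leq0n d.+1).
have card_mul u v : (distmx a *m distmx b) u v =
    #|[set w | (Defs.dist e (f u) w == a) && (Defs.dist e (f v) w == b)]|%:R.
  rewrite -sum1dep_card natr_sum [RHS]big_mkcond (reindex f) /=; last exact: onW_bij.
  rewrite mxE; apply: eq_bigr => w _; rewrite !mxE (dist_sym e_sym e_conn (f v)).
  by rewrite -natrM mulnb; case: andP.
apply/eqP; rewrite -(eqr_nat C) -!card_mul; apply/eqP.
by apply: V_dist_const (leqnn _) _ eq_dist; apply: V_mul_reduce (VD a _) (VD b _).
Qed.

End DistanceMatrices.

(** * Diameter, odd-girth and intersection numbers *)

Lemma generalized_odd_graph_of_enumeration (C : numClosedFieldType) (T : finType)
    (e : rel T) (d n : nat) (f : 'I_n.+1 -> T) : bijective f ->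
  symmetric e -> irreflexive e -> connected_graph e -> regular_graph e ->
  num_distinct_eigenvalues (\matrix_(i, j) (e (f i) (f j))%:R%R : 'M[C]_n.+1)%R d.+1 ->
  (exists2 g : nat, is_odd_girth e g & 2 * d + 1 <= g) ->
  generalized_odd_graph e.
Proof.
move=> f_bij e_sym e_irr e_conn [k e_reg] [s [s_uniq size_s s_eig]].
move=> [g [[c [c_cyc odd_c size_c]] g_min] le_dg].
have [h fK hK] := f_bij.
pose m : {poly C} := (\prod_(a <- s) ('X - a%:P))%R.
have m_monic : (m \is monic)%R by apply: monic_prod_XsubC.
have size_m : size m = d.+2 by rewrite size_prod_XsubC size_s.
have m_A := horner_minpoly e_sym s_eig.
have ones_A := horner_all_ones e_sym e_conn f_bij e_reg s_uniq size_s s_eig.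
have dist_le_f := dist_leq_spectrum e_sym e_conn f_bij e_reg s_uniq size_s s_eig.
have cyc_ge c' : graph_cycle e c' -> odd (size c') -> 2 * d + 1 <= size c'.
  by move=> cyc' odd'; apply: leq_trans le_dg (g_min c' cyc' odd').
have ex_cyc : exists2 c, graph_cycle e c & odd (size c) by exists c.
have dist_le x y : dist e x y <= d by rewrite -[x]hK -[y]hK dist_le_f.
have diamE : diameter e = d.
  apply/eqP; rewrite eqn_leq; apply/andP; split.
    by apply/bigmax_leqP => x _; apply/bigmax_leqP => y _.
  have [i [j <-]] := dist_attained e_sym e_irr e_conn f_bij m_monic size_m m_A
    dist_le_f cyc_ge ex_cyc (leqnn d).
  by apply: leq_trans (leq_bigmax (f i)); apply: leq_bigmax.
split; rewrite ?diamE; last first.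
  split=> //.
  (* Geodesics from the ends of an edge to an equidistant vertex close up to an odd walk of length
     at most [2 * d + 1]. *)
  have [u [v [uv eq_uv]]] := odd_cycle_equidistant_edge e_sym e_conn (f ord0) c_cyc odd_c.
  have uu : walk_of_length e u u ((dist e v (f ord0)).+1 + dist e u (f ord0)).
    apply: (walk_cat (y := f ord0)); last by rewrite walk_sym // dist_walk.
    by rewrite walkS; apply/existsP; exists v; rewrite uv dist_walk.
  have [|c' [cyc' odd' le_c']] := odd_closed_walk_odd_cycle e_irr uu.
    by rewrite eq_uv addSn addnn /= odd_double.
  exists c'; split=> //; apply/eqP; rewrite eqn_leq cyc_ge // andbT.
  apply: leq_trans le_c' _; have := dist_le u (f ord0); have := dist_le v (f ord0); lia.
split=> //.
pose count u v i j := #|[set w | (dist e u w == i) && (dist e v w == j)]|.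
(* The numbers are read off from any one pair at distance [l]; the default 0 occurs only when there
   is no such pair. *)
exists (fun l i j => if [pick uv : T * T | dist e uv.1 uv.2 == l] is Some uv
                     then count uv.1 uv.2 i j else 0).
rewrite diamE => l i j _ le_id le_jd u v distuv.
case: pickP => [[u' v'] /= /eqP distuv'|/(_ (u, v))]; last by rewrite /= distuv eqxx.
rewrite /count -[u]hK -[v]hK -[u']hK -[v']hK.
apply: (card_dist_const e_sym e_irr e_conn f_bij m_monic size_m m_A ones_A) => //.
by rewrite !hK distuv.
Qed.

Theorem mainTheorem1 (C : numClosedFieldType) (T : finType) (e : rel T)
    (d : nat) (e_sym : symmetric e) (e_irr : irreflexive e)
    (e_conn : connected_graph e) (e_reg : regular_graph e)
    (e_eig : num_distinct_eigenvalues (adjacency_matrix e C) d.+1)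
    (e_og : exists2 g : nat, is_odd_girth e g & 2 * d + 1 <= g) :
  generalized_odd_graph e.
Proof.
have [/card_gt0P[x _] _] := e_conn.
have rank_x := enum_rank x.
have enum_bij : bijective (@enum_val T T) by apply: enum_val_bij.
move: e_eig; rewrite /adjacency_matrix.
(* Matrices form a ring only in successor dimension, so [#|T|] is generalised to [n.+1]; the rank of
   [x] excludes 0. *)
move: rank_x (@enum_val T T) enum_bij; case: #|T| => [[]//|n] _ f f_bij eig.
exact: generalized_odd_graph_of_enumeration f_bij e_sym e_irr e_conn e_reg eig e_og.
Qed.
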